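(* Let $\mathcal{X}$ be a finite non-empty set, let $\mathscr{T}$ be a separately specified set of transition matrices on $\mathcal{X}$, and let $\overline{T}$ be the corresponding upper transition operator. Then the imprecise Markov chain under repetition independence $\mathscr{P}^{\mathrm{ri}}_{\mathscr{T}}$ is weakly ergodic if and only if $\overline{T}$ is top class absorbing (TCA). Furthermore, in that case, $\overline{E}^{\mathrm{ri}}_{\mathrm{av},\infty}(f)=\overline{E}_{\mathrm{av},\infty}(f)$ for all $f\in\mathcal{L}(\mathcal{X})$.
   Context: $\mathcal{L}(\mathcal{X})$ is the set of all functions $\mathcal{X}\to\mathbb{R}$; inequalities and limits of functions are pointwise. $\mathbb{N}=\{1,2,\dots\}$. $\mathbb{I}_A$ is the indicator of $A\subseteq\mathcal{X}$, $\mathbb{I}_x:=\mathbb{I}_{\{x\}}$, $A^c:=\mathcal{X}\setminus A$. Separately specified set: for each $x\in\mathcal{X}$ a non-empty set $\mathscr{T}_x$ of probability mass functions on $\mathcal{X}$ is given, and $\mathscr{T}$ is the set of all row-stochastic $|\mathcal{X}|\times|\mathcal{X}|$ matrices $T$ with $T(x,\cdot)\in\mathscr{T}_x$ for all $x$ (not assumed closed or convex). A matrix acts by $Th(x)=\sum_y T(x,y)h(y)$. The corresponding upper transition operator $\overline{T}:\mathcal{L}(\mathcal{X})\to\mathcal{L}(\mathcal{X})$ is $\overline{T}h(x):=\sup_{T\in\mathscr{T}}Th(x)$. A probability model $\mathrm{P}$ for a process $X_1X_2\cdots$ in $\mathcal{X}$ specifies mass functions $\mathrm{P}(X_{k+1}=\cdot\mid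 X_{1:k}=x_{1:k})$ for all $k\in\mathbb{N}$, $x_{1:k}\in\mathcal{X}^k$ (initial distributions play no role). $\mathscr{P}^{\mathrm{ei}}_{\mathscr{T}}$ (epistemic irrelevance) is the set of all $\mathrm{P}$ with $\mathrm{P}(X_{k+1}=\cdot\mid X_{1:k}=x_{1:k})\in\mathscr{T}_{x_k}$ for all $k$, $x_{1:k}$; $\mathscr{P}^{\mathrm{ci}}_{\mathscr{T}}$ (complete independence) is the subset of those with the Markov property, i.e. the mass functions depend only on $k$ and $x_k$; $\mathscr{P}^{\mathrm{ri}}_{\mathscr{T}}$ (repetition independence) is the subset of time-homogeneous Markov chains, i.e. those given by a single transition matrix $T\in\mathscr{T}$. For $f\in\mathcal{L}(\mathcal{X})$ let $f_{\mathrm{av}}(X_{1:k}):=\frac1k\sum_{i=1}^k f(X_i)$ and $$\mathrm{E}_{\mathrm{P}}(f_{\mathrm{av}}(X_{1:k})\mid X_1=x_1)=\sum_{x_{2:k}\in\mathcal{X}^{k-1}}\Big(\tfrac1k\sum_{i=1}^k f(x_i)\Big)\prod_{i=1}^{k-1}\mathrm{P}(X_{i+1}=x_{i+1}\mid X_{1:i}=x_{1:i}).$$ Let $\overline{E}^{\mathrm{ri}}_{\mathrm{av},k}(f\mid x)$ be the supremum of $\mathrm{E}_{\mathrm{P}}(f_{\mathrm{av}}(X_{1:k})\mid X_1=x)$ over $\mathrm{P}\in\mathscr{P}^{\mathrm{ri}}_{\mathscr{T}}$, and let $\overline{E}_{\mathrm{av},k}(f\mid x)$ be the supremum over $\mathrm{P}\in\mathscr{P}^{\mathrm{ei}}_{\mathscr{T}}$;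 it is known that the supremum over $\mathscr{P}^{\mathrm{ci}}_{\mathscr{T}}$ is the same and that, with $\overline{T}_fh:=f+\overline{T}h$ and $T_fh:=f+Th$, $\overline{E}_{\mathrm{av},k}(f\mid x)=\frac1k[\overline{T}_f^{\,k}(0)](x)$ and $\overline{E}^{\mathrm{ri}}_{\mathrm{av},k}(f\mid x)=\sup_{T\in\mathscr{T}}\frac1k[T_f^k(0)](x)$. $\mathscr{P}^{\mathrm{ri}}_{\mathscr{T}}$ is weakly ergodic if for every $f\in\mathcal{L}(\mathcal{X})$ the limit $\overline{E}^{\mathrm{ri}}_{\mathrm{av},\infty}(f):=\lim_{k\to+\infty}\overline{E}^{\mathrm{ri}}_{\mathrm{av},k}(f\mid x)$ exists for all $x$ and does not depend on $x$. Likewise $\overline{E}_{\mathrm{av},\infty}(f):=\lim_{k\to+\infty}\overline{E}_{\mathrm{av},k}(f\mid x)$ when this limit exists for all $x$ and does not depend on $x$ (which is the case for all $f$ when $\overline{T}$ is TCA). The graph $\mathscr{G}(\overline{T})$ has vertex set $\mathcal{X}$ and an edge from $x$ to $y$ iff $\overline{T}\mathbb{I}_y(x)>0$. Write $x\to y$ if $x=y$ or there is a directed path from $x$ to $y$. Communication classes are the equivalence classes of ''$x\to y$ and $y\to x$''. For communication classes $A,B$ write $A\to B$ if $x\to y$ for some (equivalently all) $x\in A,y\in B$. A top class is a communication class $\mathcal{R}$ with $A\to\mathcal{R}$ for every communication class $A$. A non-empty $\mathcal{S}\subseteq\mathcal{X}$ is closed if $x\not\to y$ for all $x\in\mathcal{S}$,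 $y\in\mathcal{S}^c$ (a top class is closed). A closed $\mathcal{S}$ is absorbing if for every $x\in\mathcal{S}^c$ there is $k\in\mathbb{N}$ with $\overline{T}^{\,k}\mathbb{I}_{\mathcal{S}^c}(x)<1$. $\overline{T}$ is top class absorbing (TCA) if it has a top class and this top class is absorbing. *)

(* Defs.v *)
From HB Require Import structures.
From mathcomp Require Import all_boot all_order all_algebra.
From mathcomp Require Import all_classical all_reals all_analysis.

Set Implicit Arguments.
Unset Strict Implicit.
Unset Printing Implicit Defensive.

Import Order.TTheory GRing.Theory Num.Theory.
Import numFieldNormedType.Exports.

Local Open Scope classical_set_scope.
Local Open Scope ring_scope.

Definition mass_function (R : realType) (X : finType) (p : X -> R) : Prop :=
  (forall x, 0 <= p x) /\ \sum_x p x = 1.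

(* A |X| x |X| matrix is a function T : X -> X -> R with rows T x.  The set of
   transition matrices is separately specified by the sets Tx x of possible
   rows. *)
Definition transition_matrices (R : realType) (X : finType)
    (Tx : X -> set (X -> R)) : set (X -> X -> R) :=
  [set T | forall x, mass_function (T x) /\ Tx x (T x)].

Definition mxact (R : realType) (X : finType) (T : X -> X -> R)
    (h : X -> R) : X -> R :=
  fun x => \sum_y T x y * h y.

Definition upper_transition (R : realType) (X : finType)
    (Tx : X -> set (X -> R)) (h : X -> R) : X -> R :=
  fun x => sup [set mxact T h x | T in transition_matrices Tx].

Section Graph.
Variables (R : realType) (X : finType) (U : (X -> R) -> X -> R).

Definition edge : rel X := fun x y => 0 < U (\1_[set y] : X -> R) x.

(* [connect] is the reflexive transitive closure. *)
Definition reach : rel X := connect edge.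

Definition comm_class (A : set X) : Prop :=
  exists x, A = [set y | reach x y /\ reach y x].

Definition class_reach (A B : set X) : Prop :=
  exists x y, [/\ A x, B y & reach x y].

Definition top_class (S : set X) : Prop :=
  comm_class S /\ forall A, comm_class A -> class_reach A S.

Definition closed_class (S : set X) : Prop :=
  S !=set0 /\ forall x y, S x -> (~` S) y -> ~ reach x y.

Definition absorbing (S : set X) : Prop :=
  closed_class S /\
  forall x, (~` S) x ->
    exists k : nat, (0 < k)%N /\ iter k U (\1_(~` S) : X -> R) x < 1.

(* There is at most one top class, so "the top class is absorbing" is an
   existential. *)
Definition TCA : Prop := exists S, top_class S /\ absorbing S.

End Graph.

(* P (x_1 :: ... :: x_k) is the mass function of X_{k+1} given
   X_{1:k} = x_{1:k}.  The value of P at the empty history would be an initial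
   distribution; it is left unconstrained and never used. *)
Definition prob_model (R : realType) (X : finType)
    (P : seq X -> X -> R) : Prop :=
  forall s, s != [::] -> mass_function (P s).

Definition models_ei (R : realType) (X : finType) (Tx : X -> set (X -> R)) :
    set (seq X -> X -> R) :=
  [set P | prob_model P /\ forall s x, Tx x (P (rcons s x))].

Definition models_ri (R : realType) (X : finType) (Tx : X -> set (X -> R)) :
    set (seq X -> X -> R) :=
  [set P | prob_model P /\
    exists2 T, transition_matrices Tx T & forall s x, P (rcons s x) = T x].

(* E_P(f_av(X_{1:k}) | X_1 = x) for k >= 1; the summation variable t is x_{2:k},
   and for s = x_{1:k} the entry x_{i+1} is [nth x s i]. *)
Definition expect_av (R : realType) (X : finType) (P : seq X -> X -> R)
    (k : nat) (f : X -> R) (x : X) : R :=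
  \sum_(t : k.-1.-tuple X)
    let s := x :: t in
    (k%:R^-1 * \sum_(z <- s) f z) *
    \prod_(1 <= i < k) P (take i s) (nth x s i).

Definition upper_av (R : realType) (X : finType)
    (M : set (seq X -> X -> R)) (k : nat) (f : X -> R) (x : X) : R :=
  sup [set expect_av P k f x | P in M].

(* The limit of the upper expected time averages of f exists for every initial
   state and equals l, independently of the state.  The (meaningless) value at
   k = 0 does not affect the limit. *)
Definition upper_av_limit (R : realType) (X : finType)
    (M : set (seq X -> X -> R)) (f : X -> R) (l : R) : Prop :=
  forall x : X, upper_av M k f x @[k --> \oo] --> l.

Definition weakly_ergodic (R : realType) (X : finType)
    (M : set (seq X -> X -> R)) : Prop :=
  forall f : X -> R, exists l : R, upper_av_limit M f l.

(* Main.v *)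
Require Import Defs.
From HB Require Import structures.
From mathcomp Require Import all_boot all_order all_algebra.
From mathcomp Require Import all_classical all_reals all_analysis.
From mathcomp Require Import ring lra.

Set Implicit Arguments.
Unset Strict Implicit.
Unset Printing Implicit Defensive.

Import Order.TTheory GRing.Theory Num.Theory.
Import numFieldNormedType.Exports.

Local Open Scope classical_set_scope.
Local Open Scope ring_scope.

(* Under TCA, any [w] with [|U w - w| <= D] has a span bounded in terms of [D]
   only: inside the top class, the states communicate, and outside of it, every
   chain is absorbed uniformly fast.  The discounted value iterates satisfy such
   a bound uniformly in the discount factor and thus give, for every [e > 0], a
   function [h] and a constant [l] with [|f + U h - h - l| <= e].  Then the
   iterates of [f + U] grow at rate at most [l + 2 e], while the iterates of
   [f + T], for a single [T] that is [e]-optimal for [h], grow at rate at least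
   [l - 3 e], so both limits are the common limit of the [l]'s.  Conversely,
   without TCA there is a set [B], disjoint from a closed class [S], with
   [U \1_B = 1] on [B]; the upper averages of [\1_(~` S)] then differ on [B]
   and on [S]. *)

(** * Uniform bounds over a finite set, and averages *)

(** The maximum of finitely many thresholds; [c0] allows asking for a nonnegative bound as well. *)
Lemma finite_uniform (d : Order.disp_t) (V : orderType d) (X : finType)
    (Q : X -> V -> Prop) (c0 : V) :
  (forall x c c', (c <= c')%O -> Q x c -> Q x c') ->
  (forall x, exists c, Q x c) -> exists c, (c0 <= c)%O /\ forall x, Q x c.
Proof.
move=> Qmono Qex.
suff [c [c0c Qc]] : exists c, (c0 <= c)%O /\ forall x, x \in enum X -> Q x c.
  by exists c; split=> // x; apply: Qc; rewrite mem_enum.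
elim: (enum X) => [|x s [c [c0c IHc]]]; first by exists c0.
have [c' Qxc'] := Qex x; exists (Order.max c c').
split=> [|y]; first by rewrite le_max c0c.
rewrite inE => /predU1P[->|ys]; first by apply: Qmono Qxc'; rewrite le_max lexx orbT.
by apply: Qmono (IHc y ys); rewrite le_max lexx.
Qed.

Lemma mass_average_le (R : realType) (X : finType) (p g h : X -> R) (a c : R) :
  mass_function p -> (forall y, h y <= c + a * g y) ->
  \sum_y p y * h y <= c + a * \sum_y p y * g y.
Proof.
move=> [p_ge0 p_sum] hg.
rewrite -[c in c + _]mulr1 -p_sum !mulr_sumr -big_split /=.
apply: ler_sum => y _; apply: le_trans (ler_wpM2l (p_ge0 y) (hg y)) _.
by rewrite mulrDr mulrC mulrCA.
Qed.

(** * The upper transition operator: choice of matrices and affine comparisons *)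

Section UpperTransition.
Variables (R : realType) (X : finType) (Tx : X -> set (X -> R)).
Hypothesis Tx_neq0 : forall x, Tx x !=set0.
Hypothesis Tx_mass : forall x p, Tx x p -> mass_function p.

Local Notation U := (upper_transition Tx).
Local Notation TT := (transition_matrices Tx).

(** Separate specification: the rows can be chosen independently of each other. *)
Lemma transition_matrix_select (P : X -> (X -> R) -> Prop) :
  (forall x, exists2 p, Tx x p & P x p) ->
  exists T, TT T /\ forall x, P x (T x).
Proof.
move=> exP.
have /choice[T TP] : forall x, exists p, Tx x p /\ P x p.
  by move=> x; have [p Txp Pp] := exP x; exists p.
exists T; split=> x; have [Txp Pp] := TP x => //.
by split=> //; exact: Tx_mass Txp.
Qed.

Lemma transition_matrices_neq0 : exists T, TT T.
Proof.
have [|T [TT_T _]] := @transition_matrix_select (fun _ _ => True).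
  by move=> x; have [p Txp] := Tx_neq0 x; exists p.
by exists T.
Qed.

Lemma mxact_has_sup h x : has_sup [set mxact T h x | T in TT].
Proof.
split.
  by have [T TT_T] := transition_matrices_neq0; exists (mxact T h x), T.
exists (\sum_y `|h y|) => _ [T TT_T <-].
have [[T_ge0 T_sum] _] := TT_T x.
apply: ler_sum => y _; apply: le_trans (ler_norm _) _.
rewrite normrM ger0_norm // -[leRHS]mul1r ler_wpM2r //.
by rewrite -T_sum (bigD1 y) //= lerDl sumr_ge0.
Qed.

Lemma mxact_le_upper T h x : TT T -> mxact T h x <= U h x.
Proof.
by move=> TT_T; apply: sup_upper_bound; [exact: mxact_has_sup|exists T].
Qed.

Lemma upper_le h x c :
  (forall T, TT T -> mxact T h x <= c) -> U h x <= c.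
Proof.
move=> Tc; apply: ge_sup; first by have [] := mxact_has_sup h x.
by move=> _ [T TT_T <-]; exact: Tc.
Qed.

(** The supremum need not be attained, but rowwise choice gives one matrix that is nearly optimal in
    all states at once. *)
Lemma upper_adherent h e : 0 < e ->
  exists T, TT T /\ forall x, U h x - e < mxact T h x.
Proof.
move=> e_gt0.
have [|T [TT_T TP]] := @transition_matrix_select
    (fun x p => U h x - e < \sum_y p y * h y); last by exists T.
move=> x; have [_ [T TT_T <-] TP] := sup_adherent e_gt0 (mxact_has_sup h x).
by exists (T x) => //; have [] := TT_T x.
Qed.

Lemma mxact_affine_le T (g h : X -> R) (a c : R) x : TT T ->
  (forall y, h y <= c + a * g y) -> mxact T h x <= c + a * mxact T g x.
Proof. by move=> TT_T; apply: mass_average_le; have [] := TT_T x. Qed.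

Lemma upper_affine_le (g h : X -> R) (a c : R) x : 0 <= a ->
  (forall y, h y <= c + a * g y) -> U h x <= c + a * U g x.
Proof.
move=> a_ge0 hg; apply: upper_le => T TT_T.
apply: le_trans (mxact_affine_le x TT_T hg) _.
by rewrite lerD2l ler_wpM2l // mxact_le_upper.
Qed.

Lemma upper_affine_ge (g h : X -> R) (a c : R) x : 0 <= a ->
  (forall y, c - a * g y <= h y) -> c - a * U g x <= U h x.
Proof.
move=> a_ge0 gh; have [T TT_T] := transition_matrices_neq0.
have : mxact T (fun y => - h y) x <= - c + a * mxact T g x.
  by apply: mxact_affine_le => // y; have := gh y; lra.
have -> : mxact T (fun y => - h y) x = - mxact T h x.
  by rewrite /mxact -sumrN; apply: eq_bigr => y _; rewrite mulrN.
have := ler_wpM2l a_ge0 (mxact_le_upper g x TT_T).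
by have := mxact_le_upper h x TT_T; lra.
Qed.

Lemma upper_shift_le (g h : X -> R) (c : R) x :
  (forall y, h y <= c + g y) -> U h x <= c + U g x.
Proof.
move=> hg; rewrite -[U g x]mul1r; apply: upper_affine_le => // y.
by rewrite mul1r.
Qed.

Lemma upper_cst_le (h : X -> R) (c : R) x : (forall y, h y <= c) -> U h x <= c.
Proof.
move=> hc; rewrite -[c]addr0 -[0](mul0r (U (fun=> 0) x)).
by apply: upper_affine_le => // y; rewrite mul0r addr0.
Qed.

Lemma upper_cst_ge (h : X -> R) (c : R) x : (forall y, c <= h y) -> c <= U h x.
Proof.
move=> hc; rewrite -[c]subr0 -[0](mul0r (U (fun=> 0) x)).
by apply: upper_affine_ge => // y; rewrite mul0r subr0.
Qed.

Lemma upper_indic_ge0 (A : set X) k x : 0 <= iter k U (\1_A) x.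
Proof.
elim: k x => [|k IHk] x /=; first by rewrite indicE.
exact: upper_cst_ge.
Qed.

Lemma upper_indic_le1 (A : set X) k x : iter k U (\1_A) x <= 1.
Proof.
elim: k x => [|k IHk] x /=; first by rewrite indicE; case: (_ \in _).
exact: upper_cst_le.
Qed.

(** * Stable sets, which the chain cannot leave *)

(* Both closed classes and the set reachable from a state are of this kind. *)
Definition stable (S : set X) := forall x y, S x -> reach U x y -> S y.

(** A positive entry [T x y] would be an edge from [x] to [y]. *)
Lemma stable_mxact0 (S : set X) T x y :
  stable S -> TT T -> S x -> ~ S y -> T x y = 0.
Proof.
move=> Sst TT_T Sx NSy; apply/eqP; case: eqP => // /eqP Txy_neq0.
case: NSy; apply: (Sst x) => //; apply: connect1; rewrite /edge.
apply: lt_le_trans (mxact_le_upper (\1_[set y]) x TT_T).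
rewrite /mxact (bigD1 y) //= big1 => [|z /negPf zy].
  rewrite addr0 indicE mem_set // mulr1 lt_neqAle eq_sym Txy_neq0 /=.
  by have [[]] := TT_T x.
by rewrite indicE memNset ?mulr0 // => /eqP; rewrite zy.
Qed.

Lemma stable_mxact_le (S : set X) T (g h : X -> R) (a c : R) x :
  stable S -> TT T -> S x -> (forall y, S y -> h y <= c + a * g y) ->
  mxact T h x <= c + a * mxact T g x.
Proof.
move=> Sst TT_T Sx hg.
(* Row [x] puts no mass outside [S], so [h] may be replaced there by the bound itself. *)
pose h' y := if y \in S then h y else c + a * g y.
have -> : mxact T h x = mxact T h' x.
  apply: eq_bigr => y _; rewrite /h'; case: ifPn => // /negP NSy.
  rewrite (stable_mxact0 Sst TT_T Sx) ?mul0r // => Sy.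
  by apply: NSy; rewrite inE.
apply: mxact_affine_le => // y; rewrite /h'; case: ifPn => // yS.
by apply: hg; rewrite inE in yS.
Qed.

Lemma stable_upper_indic0 (S : set X) k x :
  stable S -> S x -> iter k U (\1_(~` S)) x = 0.
Proof.
move=> Sst Sx; apply/eqP; rewrite eq_le upper_indic_ge0 andbT.
elim: k x Sx => [|k IHk] x Sx /=.
  by rewrite indicE memNset //; apply/not_notP.
apply: upper_le => T TT_T.
rewrite -[leRHS]addr0 -[X in _ + X](mul0r (mxact T (fun=> 0) x)).
by apply: stable_mxact_le Sst TT_T Sx _ => y Sy; rewrite mul0r addr0 IHk.
Qed.

(** The first step decreases because the iterates vanish on [S] and start at 1 off [S]; monotonicity
    of [U] carries this on. *)
Lemma stable_upper_indic_decr (S : set X) k m x :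
  stable S -> (k <= m)%N ->
  iter m U (\1_(~` S)) x <= iter k U (\1_(~` S)) x.
Proof.
move=> Sst km; have step n : forall y,
    iter n.+1 U (\1_(~` S)) y <= iter n U (\1_(~` S)) y.
  elim: n => [|n IHn] y.
    have [Sy|NSy] := pselect (S y).
      by rewrite !stable_upper_indic0.
    by rewrite [leRHS]indicE mem_set // upper_indic_le1.
  rewrite /= -[leRHS]add0r.
  by apply: upper_shift_le => z; rewrite add0r; exact: IHn.
elim: m km => [|m IHm]; first by rewrite leqn0 => /eqP->.
rewrite leq_eqVlt => /predU1P[->//|/IHm]; exact: le_trans (step _ _).
Qed.

Lemma mxact_indic1 (T : X -> X -> R) x z a :
  mxact T (fun y => a * \1_[set z] y) x = T x z * a.
Proof.
rewrite /mxact (bigD1 z) //= big1 => [|y /negPf yz].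
  by rewrite addr0 indicE mem_set // mulr1.
by rewrite indicE memNset ?mulr0 // => /eqP; rewrite yz.
Qed.

(** * The span bound under TCA *)

Lemma edge_mxact_gt0 x z : edge U x z -> exists T, TT T /\ 0 < T x z.
Proof.
move=> Uxz; have [T [TT_T /(_ x)]] := upper_adherent (\1_[set z]) Uxz.
rewrite subrr => Txz; exists T; split=> //; apply: lt_le_trans Txz _.
rewrite -[leRHS]mulr1 -mxact_indic1 le_eqVlt; apply/orP; left.
by apply/eqP/eq_bigr => y _; rewrite mul1r.
Qed.

(** Along an edge, [T x z * (w z - m) <= mxact T w x - m <= w x + D - m], since [w >= m] on [S];
    dividing by [T x z] gives the constant for [z]. It is fixed before [w] and [m]. *)
Lemma stable_reach_bound (S : set X) (D : R) x y (c : R) :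
  stable S -> S x -> reach U x y ->
  exists C, forall (w : X -> R) m, (forall z, U w z <= w z + D) ->
    (forall z, S z -> m <= w z) -> w x <= m + c -> w y <= m + C.
Proof.
move=> Sst Sx /connectP[p]; elim: p x c Sx => [|z p IHp] x c Sx /=.
  by move=> _ ->; exists c.
case/andP=> Uxz pth ylast; have [T [TT_T Txz_gt0]] := edge_mxact_gt0 Uxz.
have Sz : S z by apply: Sst (Sx) _; exact: connect1.
have [C CP] := IHp z ((c + D) / T x z) Sz pth ylast.
exists C => w m wU wm wx; apply: CP => //.
rewrite -lerBlDl ler_pdivlMr // mulrC -mxact_indic1.
have : mxact T (fun y => (w z - m) * \1_[set z] y) x <= - m + 1 * mxact T w x.
  apply: stable_mxact_le Sst TT_T Sx _ => v Sv; rewrite indicE.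
  have [->|vz] := eqVneq v z; first by rewrite mem_set // mulr1; lra.
  rewrite memNset ?mulr0; first by have := wm v Sv; lra.
  by move=> /eqP; exact/negP.
by have := mxact_le_upper w x TT_T; have := wU x; lra.
Qed.

Lemma top_class_stable (S : set X) : top_class U S -> absorbing U S ->
  [/\ S !=set0, stable S & forall x y, S x -> S y -> reach U x y].
Proof.
move=> [[a Sa] _] [[S0 Scl] _]; split=> // x y.
  by move=> Sx xy; apply/not_notP => NSy; exact: (Scl x y).
by rewrite Sa => -[_ xa] [ay _]; exact: connect_trans ay.
Qed.

(** As the iterates decrease and [X] is finite, one [k] serves all states; [r] is the largest
    value. *)
Lemma absorbing_uniform (S : set X) : stable S -> absorbing U S ->
  exists k (r : R), r < 1 /\ forall x, iter k U (\1_(~` S)) x <= r.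
Proof.
move=> Sst [[[x0 _] _] Sabs].
have [|x|k [_ kP]] := @finite_uniform _ nat X
    (fun x k => iter k U (\1_(~` S)) x < 1) 0%N.
- by move=> x k m km; apply: le_lt_trans; exact: stable_upper_indic_decr.
- have [Sx|/Sabs[k [_ kP]]] := pselect (S x); last by exists k.
  by exists 0%N; rewrite stable_upper_indic0.
exists k; exists (iter k U (\1_(~` S)) [arg max_(x > x0) iter k U (\1_(~` S)) x]%O).
by case: arg_maxP => // xM _ xMP; split=> // x; exact: xMP.
Qed.

Lemma TCA_span (D : R) : 0 <= D -> TCA U ->
  exists C, forall w : X -> R, (forall x, `|U w x - w x| <= D) ->
    forall x y, w x <= w y + C.
Proof.
move=> D_ge0 [S [Stop Sabs]].
have [[x0 Sx0] Sst Sreach] := top_class_stable Stop Sabs.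
have [k [r [r_lt1 rP]]] := absorbing_uniform Sst Sabs.
have [|[x y]|C1 [C1_ge0 C1P]] := @finite_uniform _ R (X * X)%type (fun xy C =>
    S xy.1 -> S xy.2 -> forall (w : X -> R) m,
    (forall z, U w z <= w z + D) -> (forall z, S z -> m <= w z) ->
    w xy.1 <= m -> w xy.2 <= m + C) 0.
- move=> [x y] c c' cc' /= HQ Sx Sy w m wU wm wx.
  by apply: le_trans (HQ Sx Sy w m wU wm wx) _; rewrite lerD2l.
- have [[Sx Sy]|NS] := pselect (S x /\ S y); last first.
    by exists 0 => Sx Sy; case: NS.
  have [C CP] := stable_reach_bound D 0 Sst Sx (Sreach x y Sx Sy).
  by exists C => _ _ w m wU wm wx; apply: CP => //; rewrite addr0.
have r1_gt0 : 0 < 1 - r by rewrite subr_gt0.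
exists (C1 + 2 * (k%:R * D / (1 - r))) => w wU.
have wU1 z : U w z <= w z + D by have := wU z; rewrite ler_norml; lra.
have wU2 z : w z <= D + U w z by have := wU z; rewrite ler_norml; lra.
case: (@arg_minP _ _ _ x0 (mem S) w); first by rewrite inE.
move=> xm; rewrite /= inE => Sxm xmP.
have wm z : S z -> w xm <= w z by move=> Sz; apply: xmP; rewrite inE.
have wM z : S z -> w z <= w xm + C1 by move=> Sz; exact: (C1P (xm, z)).
pose u j := iter j U (\1_(~` S) : X -> R).
(* Outside [S], [w] is compared with its values on [S] along [k] steps of the
   chain, during which [S] is hit with probability at least [1 - r]. *)
have upper M a j z : 0 <= a -> (forall z, S z -> w z <= M) ->
    (forall z, w z <= M + a) -> w z <= M + j%:R * D + a * u j z.
  move=> a_ge0 SM wMa; elim: j z => [|j IHj] z.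
    rewrite mul0r addr0 /u /= indicE; have [Sz|NSz] := pselect (S z).
      by rewrite memNset ?mulr0 ?addr0 ?SM //; apply/not_notP.
    by rewrite mem_set // mulr1.
  apply: le_trans (wU2 z) _; rewrite mulrSr.
  have := @upper_affine_le (u j) w a (M + j%:R * D) z a_ge0 IHj.
  by rewrite /u iterS; lra.
have lower m a j z : 0 <= a -> (forall z, S z -> m <= w z) ->
    (forall z, m - a <= w z) -> m - j%:R * D - a * u j z <= w z.
  move=> a_ge0 Sm wma; elim: j z => [|j IHj] z.
    rewrite mul0r subr0 /u /= indicE; have [Sz|NSz] := pselect (S z).
      by rewrite memNset ?mulr0 ?subr0 ?Sm //; apply/not_notP.
    by rewrite mem_set // mulr1.
  have := @upper_affine_ge (u j) w a (m - j%:R * D) z a_ge0 IHj.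
  have := wU1 z; rewrite mulrSr.
  by rewrite /u iterS; lra.
have kD_ge0 : 0 <= k%:R * D by rewrite mulr_ge0.
(* With the largest excess itself as [a], [k] steps reproduce it up to the factor [r] and an error
   [k%:R * D], which bounds [a]. *)
have small a : 0 <= a -> a <= k%:R * D + a * r -> a <= k%:R * D / (1 - r).
  by move=> _ aP; rewrite ler_pdivlMr //; lra.
have max_bd x : w x <= w xm + C1 + k%:R * D / (1 - r).
  case: (@arg_maxP _ _ _ x0 predT w) => // xM _ xMP.
  apply: le_trans (xMP x isT) _; rewrite -lerBlDl.
  have [|a_gt0] := leP (w xM - (w xm + C1)) 0.
    by move/le_trans; apply; rewrite divr_ge0 // ltW.
  apply: small; first exact: ltW.
  have := upper (w xm + C1) (w xM - (w xm + C1)) k xM (ltW a_gt0) wM.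
  rewrite addrC subrK => /(_ (fun z => xMP z isT)).
  by have := ler_wpM2l (ltW a_gt0) (rP xM); rewrite -/(u k); lra.
have min_bd y : w xm - k%:R * D / (1 - r) <= w y.
  case: (@arg_minP _ _ _ x0 predT w) => // xn _ xnP.
  apply: le_trans (xnP y isT); rewrite lerBlDl -lerBlDr.
  have [|a_gt0] := leP (w xm - w xn) 0.
    by move/le_trans; apply; rewrite divr_ge0 // ltW.
  apply: small; first exact: ltW.
  have := lower (w xm) (w xm - w xn) k xn (ltW a_gt0) wm.
  rewrite opprB addrC subrK => /(_ (fun z => xnP z isT)).
  by have := ler_wpM2l (ltW a_gt0) (rP xn); rewrite -/(u k); lra.
by move=> x y; have := max_bd x; have := min_bd y; lra.
Qed.

(** * Discounted value iteration *)

Section Discounted.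
Variables (f : X -> R) (B a : R).
Hypotheses (f_ge0 : forall x, 0 <= f x) (f_le : forall x, f x <= B).
Hypotheses (a_ge0 : 0 <= a) (a_lt1 : a < 1).

Let w k := iter k (fun h x => f x + a * U h x) (fun=> 0).

Lemma discounted_ge0 k x : 0 <= w k x.
Proof.
elim: k x => [//|k IHk] x /=; rewrite addr_ge0 // mulr_ge0 //.
exact: upper_cst_ge.
Qed.

Lemma discounted_incr k x : w k x <= w k.+1 x.
Proof.
elim: k x => [|k IHk] x; first exact: discounted_ge0.
rewrite /= lerD2l ler_wpM2l // -[leRHS]add0r; apply: upper_shift_le => y.
by rewrite add0r; exact: IHk.
Qed.

Lemma discounted_incr_le k x : w k.+1 x <= a ^+ k * B + w k x.
Proof.
elim: k x => [|k IHk] x.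
  rewrite /= expr0 mul1r addr0 -[leRHS]addr0 lerD //.
  by rewrite -[leRHS](mulr0 a) ler_wpM2l //; exact: upper_cst_le.
have := @upper_shift_le (w k) (w k.+1) (a ^+ k * B) x (IHk).
move=> /(ler_wpM2l a_ge0); rewrite exprS /= -/(w k) mulrDr; lra.
Qed.

(** [B / (1 - a)] is the fixed point of the map from [v] to [B + a * v]. *)
Lemma discounted_le k x : (1 - a) * w k x <= B.
Proof.
have B_ge0 : 0 <= B := le_trans (f_ge0 x) (f_le x).
have a1_gt0 : 0 < 1 - a by rewrite subr_gt0.
rewrite mulrC -ler_pdivlMr //.
elim: k x => [|k IHk] x; first by rewrite divr_ge0 // ltW.
have := ler_wpM2l a_ge0 (@upper_cst_le (w k) (B / (1 - a)) x IHk).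
rewrite /= -/(w k) !ler_pdivlMr //.
have -> : a * (B / (1 - a)) = B / (1 - a) - B.
  by rewrite -[in X in _ = _ - X](divfK (lt0r_neq0 a1_gt0) B); ring.
move=> IH; have : f x + a * U (w k) x <= B / (1 - a) by have := f_le x; lra.
by rewrite ler_pdivlMr.
Qed.

(** The difference is [(w k.+1 x - w k x) - f x + (1 - a) * U (w k) x], where the increment, [f x]
    and the last term all lie between 0 and [B]. *)
Lemma discounted_upper k x : `|U (w k) x - w k x| <= 2 * B.
Proof.
have a1_gt0 : 0 < 1 - a by rewrite subr_gt0.
have B_ge0 : 0 <= B := le_trans (f_ge0 x) (f_le x).
have incr := discounted_incr k x; have incr_le := discounted_incr_le k x.
have akB : a ^+ k * B <= B.
  by rewrite -[leRHS]mul1r ler_wpM2r // exprn_ile1 // ltW.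
have UwB : (1 - a) * U (w k) x <= B.
  rewrite mulrC -ler_pdivlMr //; apply: upper_cst_le => y.
  by rewrite ler_pdivlMr // mulrC discounted_le.
have Uw_ge0 : 0 <= U (w k) x.
  by apply: upper_cst_ge => y; exact: discounted_ge0.
have aUw : a * U (w k) x <= U (w k) x by rewrite ler_piMl // ltW.
have := f_ge0 x; have := f_le x.
move: incr incr_le; rewrite /= -/(w k) ler_norml; lra.
Qed.

End Discounted.

(* The discounted values have a span bounded uniformly in the discount factor,
   so they solve the average reward equation approximately as the factor tends
   to one. *)
Lemma TCA_approx_ge0 (x0 : X) (f : X -> R) (e : R) :
  TCA U -> 0 < e -> (forall x, 0 <= f x) ->
  exists h l, forall x, `|f x + U h x - h x - l| <= e.
Proof.
move=> tca e_gt0 f_ge0.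
pose B := \sum_x f x.
have f_le x : f x <= B by rewrite /B (bigD1 x) //= lerDl sumr_ge0.
have B_ge0 : 0 <= B by exact: sumr_ge0.
(* The bound [2 * B] holds for every discount factor, so [C] can be fixed before it. *)
have [|C CP] := @TCA_span (2 * B) _ tca; first by rewrite mulr_ge0.
(* The discount factor will be [1 - n], with [n] times the span bound at most [e / 2]. *)
pose n := Num.min 1 (e / 2 / (`|C| + 1)).
have C1_gt0 : 0 < `|C| + 1 by rewrite ltr_wpDl.
have n_gt0 : 0 < n by rewrite lt_min ltr01 !divr_gt0.
have n_le1 : n <= 1 by rewrite ge_min lexx.
have nC : n * `|C| <= e / 2.
  have : n * (`|C| + 1) <= e / 2 by rewrite -ler_pdivlMr // ge_min lexx orbT.
  by apply: le_trans; rewrite ler_wpM2l ?lerDl // ltW.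
have a_ge0 : 0 <= 1 - n by rewrite subr_ge0.
have a_lt1 : 1 - n < 1 by rewrite gtrBl.
have [k kP] : exists k, (1 - n) ^+ k * B <= e / 2.
  have eB : 0 < e / 2 / (B + 1) by rewrite !divr_gt0 // ltr_wpDl.
  have := @cvg_expr R (1 - n); rewrite ger0_norm // => /(_ a_lt1).
  move=> /cvgr0_norm_le/(_ _ eB)[k _ /(_ k (leqnn k)) /=].
  rewrite ger0_norm ?exprn_ge0 // ler_pdivlMr ?ltr_wpDl // => kP.
  by exists k; apply: le_trans kP; rewrite ler_wpM2l ?exprn_ge0 ?lerDl.
pose w k := iter k (fun h x => f x + (1 - n) * U h x) (fun=> 0).
(* With this [l] the residual is [w k.+1 x - w k x], between 0 and [e / 2], plus
   [n * (U (w k) x - w k x0)]. *)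
exists (w k), (n * w k x0) => x.
have wU y : `|U (w k) y - w k y| <= 2 * B by exact: discounted_upper.
have := discounted_incr f_ge0 a_ge0 k x.
have := discounted_incr_le f_le a_ge0 k x.
rewrite /= -/(w k) => incr_le incr.
have Uw : `|U (w k) x - w k x0| <= `|C|.
  rewrite ler_distl; apply/andP; split.
    apply: upper_cst_ge => y; rewrite lerBlDr (le_trans (CP _ wU x0 y)) //.
    by rewrite lerD2l ler_norm.
  apply: upper_cst_le => y; rewrite (le_trans (CP _ wU y x0)) //.
  by rewrite lerD2l ler_norm.
have nUw : `|n * (U (w k) x - w k x0)| <= e / 2.
  rewrite normrM gtr0_norm //; apply: le_trans nC.
  by rewrite ler_wpM2l // ltW.
by move: nUw; rewrite !ler_norml => nUw; lra.
Qed.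

Lemma TCA_approx (x0 : X) (f : X -> R) (e : R) : TCA U -> 0 < e ->
  exists h l, forall x, `|f x + U h x - h x - l| <= e.
Proof.
(* Adding [b] makes [f] nonnegative and only moves [l] by [b]. *)
move=> tca e_gt0; pose b := \sum_x `|f x|.
have [|h [l hl]] := @TCA_approx_ge0 x0 (fun x => f x + b) e tca e_gt0.
  move=> x; rewrite -lerBlDl sub0r.
  apply: le_trans (ler_norm _) _; rewrite normrN /b (bigD1 x) //=.
  by rewrite lerDl sumr_ge0.
exists h, (l - b) => x; have := hl x.
by congr (`|_| <= _); ring.
Qed.

(** * Linear growth of the undiscounted sums *)

Definition upper_sum (f : X -> R) k :=
  iter k (fun h x => f x + U h x) (fun=> 0).
Definition mx_sum (T : X -> X -> R) (f : X -> R) k :=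
  iter k (fun h x => f x + mxact T h x) (fun=> 0).

(** Up to [e], one step raises [h] by [l], so induction compares the sums with [h] plus a linear
    term; the bounded [2 * H] costs a further [k%:R * e]. *)
Lemma upper_sum_asymptotic (f h : X -> R) (l e : R) : 0 < e ->
  (forall x, `|f x + U h x - h x - l| <= e) ->
  exists N, forall k x, (N <= k)%N -> upper_sum f k x <= k%:R * (l + 2 * e).
Proof.
move=> e_gt0 hl; pose H := \sum_x `|h x|.
have hH x : `|h x| <= H by rewrite /H (bigD1 x) //= lerDl sumr_ge0.
have bound k x : upper_sum f k x <= H + k%:R * (l + e) + h x.
  elim: k x => [|k IHk] x.
    by have := hH x; rewrite /upper_sum /= mul0r addr0 ler_norml; lra.
  have := upper_shift_le x IHk; have := hl x.
  rewrite (_ : upper_sum f k.+1 x = f x + U (upper_sum f k) x) // ler_norml mulrSr; lra.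
exists (Num.trunc (2 * H / e)).+1 => k x Nk.
have : 2 * H <= k%:R * e.
  rewrite -ler_pdivrMr //; apply: ltW; apply: lt_le_trans (truncnS_gt _) _.
  by rewrite ler_nat.
by have := bound k x; have := hH x; rewrite ler_norml; lra.
Qed.

(** A matrix that is [e]-optimal for [h] loses one more [e] per step; it serves all [k] and all
    states. *)
Lemma mx_sum_asymptotic (f h : X -> R) (l e : R) : 0 < e ->
  (forall x, `|f x + U h x - h x - l| <= e) ->
  exists2 T, TT T & exists N, forall k x, (N <= k)%N ->
    k%:R * (l - 3 * e) <= mx_sum T f k x.
Proof.
move=> e_gt0 hl; pose H := \sum_x `|h x|.
have hH x : `|h x| <= H by rewrite /H (bigD1 x) //= lerDl sumr_ge0.
have [T [TT_T TP]] := upper_adherent h e_gt0; exists T => //.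
have bound k x : h x <= H - k%:R * (l - 2 * e) + 1 * mx_sum T f k x.
  elim: k x => [|k IHk] x.
    by have := hH x; rewrite /mx_sum /= mul0r mulr0 ler_norml; lra.
  have := mxact_affine_le x TT_T IHk; have := hl x; have := TP x.
  rewrite (_ : mx_sum T f k.+1 x = f x + mxact T (mx_sum T f k) x) // ler_norml mulrSr; lra.
exists (Num.trunc (2 * H / e)).+1 => k x Nk.
have : 2 * H <= k%:R * e.
  rewrite -ler_pdivrMr //; apply: ltW; apply: lt_le_trans (truncnS_gt _) _.
  by rewrite ler_nat.
by have := bound k x; have := hH x; rewrite ler_norml; lra.
Qed.

(** * Expectations over paths and their first-step recursion *)

(** The probability of the transitions along [s]; [x] is only the default of [nth]. *)
Definition path_weight (P : seq X -> X -> R) (s : seq X) (x : X) : R :=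
  \prod_(1 <= i < size s) P (take i s) (nth x s i).

(** [k] counts transitions, so [k.+1] values of [f] are added. *)
Definition expect_sum (P : seq X -> X -> R) (f : X -> R) k x : R :=
  \sum_(t : k.-tuple X) (\sum_(z <- x :: t) f z) * path_weight P (x :: t) x.

Lemma expect_avE P k f x :
  expect_av P k.+1 f x = k.+1%:R^-1 * expect_sum P f k x.
Proof.
rewrite /expect_av /expect_sum mulr_sumr /=; apply: eq_bigr => t _.
by rewrite /path_weight /= size_tuple mulrA.
Qed.

Lemma sum_tuple0 (F : seq X -> R) : \sum_(t : 0.-tuple X) F t = F [::].
Proof.
rewrite (bigD1 [tuple]) //= big1 ?addr0 // => t /eqP[].
by apply: val_inj; rewrite /= tuple0.
Qed.

Lemma sum_tuple_cons k (F : seq X -> R) :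
  \sum_(t : k.+1.-tuple X) F t = \sum_y \sum_(t : k.-tuple X) F (y :: t).
Proof.
rewrite pair_big /= (reindex (fun yt : X * k.-tuple X => cons_tuple yt.1 yt.2)) //=.
exists (fun t : k.+1.-tuple X => (thead t, [tuple of behead t])).
  by move=> [y t] _ /=; congr pair; exact: val_inj.
by move=> t _; rewrite [RHS]tuple_eta; exact: val_inj.
Qed.

Lemma path_weight_cons P x y t :
  path_weight P (x :: y :: t) x =
  P [:: x] y * path_weight (fun s => P (x :: s)) (y :: t) y.
Proof.
rewrite /path_weight big_ltn //=; congr (_ * _).
rewrite big_add1 /= [LHS]big_nat [RHS]big_nat; apply: eq_bigr => i /andP[_ it].
by congr (P _ _); exact: set_nth_default.
Qed.

Lemma prob_model_shift (P : seq X -> X -> R) x :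
  prob_model P -> prob_model (fun s => P (x :: s)).
Proof. by move=> PP s _; exact: PP. Qed.

Lemma path_weight_sum P k x :
  prob_model P -> \sum_(t : k.-tuple X) path_weight P (x :: t) x = 1.
Proof.
elim: k P x => [|k IHk] P x PP.
  rewrite (sum_tuple0 (fun t => path_weight P (x :: t) x)).
  by rewrite /path_weight big_geq.
rewrite (sum_tuple_cons k (fun t => path_weight P (x :: t) x)).
have [_ <-] := PP [:: x] isT; apply: eq_bigr => y _.
under eq_bigr do rewrite path_weight_cons.
by rewrite -mulr_sumr IHk ?mulr1 //; exact: prob_model_shift.
Qed.

Lemma expect_sum0 P f x : expect_sum P f 0 x = f x.
Proof.
rewrite /expect_sum.
rewrite (sum_tuple0 (fun t => (\sum_(z <- x :: t) f z) * path_weight P (x :: t) x)).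
by rewrite /path_weight big_geq // mulr1 big_seq1.
Qed.

(** The first state is split off: the path weights sum to 1, and after [x] the process follows the
    shifted model. *)
Lemma expect_sumS P f k x : prob_model P ->
  expect_sum P f k.+1 x =
  f x + \sum_y P [:: x] y * expect_sum (fun s => P (x :: s)) f k y.
Proof.
move=> PP; rewrite /expect_sum.
under eq_bigr do rewrite big_cons mulrDl.
rewrite big_split /= -mulr_sumr path_weight_sum // mulr1; congr (_ + _).
rewrite (sum_tuple_cons k
  (fun t => (\sum_(z <- t) f z) * path_weight P (x :: t) x)).
apply: eq_bigr => y _; rewrite mulr_sumr; apply: eq_bigr => t _.
by rewrite path_weight_cons mulrCA.
Qed.

(** A single row at [x] extends to a full matrix. *)
Lemma mass_le_upper (p h : X -> R) x : Tx x p -> \sum_y p y * h y <= U h x.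
Proof.
move=> Txp.
have [|T [TT_T Tp]] := @transition_matrix_select (fun z q => z = x -> q = p).
  move=> z; have [->|zx] := eqVneq z x; first by exists p.
  by have [q Tzq] := Tx_neq0 z; exists q => // /eqP; rewrite (negPf zx).
by rewrite -(Tp x erefl); exact: mxact_le_upper.
Qed.

(** Induction over all models: dropping the first state leaves a model in [models_ei Tx], however it
    depends on the history. *)
Lemma expect_sum_le_upper P f k x :
  models_ei Tx P -> expect_sum P f k x <= upper_sum f k.+1 x.
Proof.
elim: k P x => [|k IHk] P x [PP PT].
  by rewrite expect_sum0 /= lerDl; exact: upper_cst_ge.
rewrite expect_sumS // (_ : upper_sum f k.+2 x = f x + U (upper_sum f k.+1) x) //.
rewrite lerD2l; have Px := PT [::] x.
apply: le_trans (mass_le_upper _ Px); apply: ler_sum => y _.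
apply: ler_wpM2l; first by have [] := Tx_mass Px.
apply: IHk; split; first exact: prob_model_shift.
by move=> s z; exact: (PT (x :: s) z).
Qed.

Lemma expect_sum_homogeneous P T f k x : prob_model P ->
  (forall s x, P (rcons s x) = T x) -> expect_sum P f k x = mx_sum T f k.+1 x.
Proof.
elim: k P x => [|k IHk] P x PP PT.
  by rewrite expect_sum0 /mx_sum /= /mxact big1 ?addr0 // => y _; rewrite mulr0.
rewrite expect_sumS //; congr (_ + _); apply: eq_bigr => y _.
rewrite IHk; first by rewrite (PT [::] x).
  exact: prob_model_shift.
by move=> s z; exact: (PT (x :: s) z).
Qed.

Lemma models_ri_ei P : models_ri Tx P -> models_ei Tx P.
Proof.
by move=> [PP [T TT_T PT]]; split=> // s x; rewrite PT; have [] := TT_T x.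
Qed.

Lemma models_ri_matrix (x0 : X) T : TT T ->
  models_ri Tx (fun s => T (last x0 s)).
Proof.
move=> TT_T; split; first by move=> s _; have [] := TT_T (last x0 s).
by exists T => // s x; rewrite last_rcons.
Qed.

Lemma expect_av_ubound f k x :
  ubound [set expect_av P k.+1 f x | P in models_ei Tx]
    (k.+1%:R^-1 * upper_sum f k.+1 x).
Proof.
move=> _ [P PM <-]; rewrite expect_avE ler_wpM2l ?invr_ge0 //.
exact: expect_sum_le_upper.
Qed.

Lemma upper_av_ei_le f k x :
  upper_av (models_ei Tx) k.+1 f x <= k.+1%:R^-1 * upper_sum f k.+1 x.
Proof.
apply: ge_sup (@expect_av_ubound f k x).
have [T TT_T] := transition_matrices_neq0.
exists (expect_av (fun s => T (last x s)) k.+1 f x).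
by exists (fun s => T (last x s)) => //; apply: models_ri_ei; exact: models_ri_matrix.
Qed.

Lemma upper_av_ri_le_ei f k x :
  upper_av (models_ri Tx) k.+1 f x <= upper_av (models_ei Tx) k.+1 f x.
Proof.
apply: ge_sup.
  have [T TT_T] := transition_matrices_neq0.
  exists (expect_av (fun s => T (last x s)) k.+1 f x).
  by exists (fun s => T (last x s)) => //; exact: models_ri_matrix.
move=> _ [P PM <-]; apply: ub_le_sup.
  by eexists; exact: expect_av_ubound.
by exists P => //; exact: models_ri_ei.
Qed.

Lemma upper_av_ri_ge T f k x : TT T ->
  k.+1%:R^-1 * mx_sum T f k.+1 x <= upper_av (models_ri Tx) k.+1 f x.
Proof.
move=> TT_T; have PM := models_ri_matrix x TT_T.
rewrite -(@expect_sum_homogeneous (fun s => T (last x s))); first last.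
- by move=> s y; rewrite last_rcons.
- by case: PM.
rewrite -expect_avE; apply: ub_le_sup; last by exists (fun s => T (last x s)).
exists (k.+1%:R^-1 * upper_sum f k.+1 x) => _ [P /models_ri_ei PE <-].
by apply: expect_av_ubound; exists P.
Qed.

(** * Existence and equality of the limits under TCA *)

Lemma TCA_limits (x0 : X) (f : X -> R) : TCA U -> exists l : R,
  upper_av_limit (models_ri Tx) f l /\ upper_av_limit (models_ei Tx) f l.
Proof.
move=> tca.
(* Eventual bounds, uniform in the state. Every [lo] bound is at most every [hi] bound, and [approx]
   gives pairs at distance [5 * e], so they meet at one [l]. *)
pose lo a := exists N, forall k x, (N <= k)%N ->
  a <= upper_av (models_ri Tx) k f x.
pose hi b := exists N, forall k x, (N <= k)%N ->
  upper_av (models_ei Tx) k f x <= b.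
have approx e : 0 < e -> exists l, lo (l - 3 * e) /\ hi (l + 2 * e).
  move=> e_gt0; have [h [l hl]] := TCA_approx x0 f tca e_gt0.
  exists l; split.
    have [T TT_T [N NP]] := mx_sum_asymptotic e_gt0 hl.
    exists N.+1 => -[//|k] x Nk; apply: le_trans (upper_av_ri_ge f k x TT_T).
    by rewrite [leRHS]mulrC ler_pdivlMr // [leLHS]mulrC NP // ltnW.
  have [N NP] := upper_sum_asymptotic e_gt0 hl.
  exists N.+1 => -[//|k] x Nk; apply: le_trans (upper_av_ei_le f k x) _.
  by rewrite [leLHS]mulrC ler_pdivrMr // [leRHS]mulrC NP // ltnW.
have lo_hi a b : lo a -> hi b -> a <= b.
  move=> [N NP] [M MP]; have kN : (N <= (maxn N M).+1)%N.
    by rewrite ltnW // ltnS leq_maxl.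
  have kM : (M <= (maxn N M).+1)%N by rewrite ltnW // ltnS leq_maxr.
  apply: le_trans (NP _ x0 kN) _.
  by apply: le_trans (upper_av_ri_le_ei _ _ _) (MP _ x0 kM).
pose l := sup [set a | lo a].
have lo_l a : lo a -> a <= l.
  move=> loa; apply: ub_le_sup => //; have [b [_ hib]] := approx 1 ltr01.
  by exists (b + 2 * 1) => c loc; exact: lo_hi.
have l_hi b : hi b -> l <= b.
  move=> hib; apply: ge_sup => [|a loa]; last exact: lo_hi.
  by have [c [loc _]] := approx 1 ltr01; exists (c - 3 * 1).
have squeeze e : 0 < e -> exists N, forall k x, (N <= k)%N ->
    l - e <= upper_av (models_ri Tx) k f x /\
    upper_av (models_ei Tx) k f x <= l + e.
  move=> e_gt0; have e5_gt0 : 0 < e / 5 by rewrite divr_gt0.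
  have [c [loc hic]] := approx _ e5_gt0.
  have := lo_l _ loc; have := l_hi _ hic.
  have [N NP] := loc; have [M MP] := hic => lc cl.
  exists (maxn N M) => k x; rewrite geq_max => /andP[Nk Mk].
  by have := NP k x Nk; have := MP k x Mk; split; lra.
exists l; split=> x; apply/cvgrPdist_le => e e_gt0;
  have [N NP] := squeeze e e_gt0; exists N.+1 => // -[//|k] /= Nk;
  have := NP k.+1 x (ltnW Nk); have := upper_av_ri_le_ei f k x;
  by rewrite ler_distlC; lra.
Qed.

(** * Necessity of TCA *)

Lemma stable_upper_sum_le0 (S : set X) k x :
  stable S -> S x -> upper_sum (\1_(~` S)) k x <= 0.
Proof.
move=> Sst; elim: k x => [x _|k IHk x Sx]; first by rewrite /upper_sum /= lexx.
rewrite (_ : upper_sum _ k.+1 x =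
  \1_(~` S) x + U (upper_sum (\1_(~` S)) k) x) //.
rewrite indicE memNset ?add0r; last by move=> /(_ Sx).
apply: upper_le => T TT_T.
rewrite -[leRHS]addr0 -[X in _ + X](mul0r (mxact T (fun=> 0) x)).
by apply: stable_mxact_le Sst TT_T Sx _ => y Sy; rewrite mul0r addr0 IHk.
Qed.

(** From [B], the chain has left [B] within [j] steps with probability at most [j * e]; summing over
    the [k] times costs at most [k ^ 2 * e]. *)
Lemma mx_sum_indic_ge T (e : R) (B D : set X) k x : TT T -> 0 <= e ->
  B `<=` D -> (forall y, B y -> 1 - e <= mxact T (\1_B) y) ->
  k%:R * \1_B x - k%:R ^+ 2 * e <= mx_sum T (\1_D) k x.
Proof.
move=> TT_T e_ge0 BD TB; elim: k x => [|k IHk] x.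
  by rewrite mul0r expr0n mul0r subr0 /mx_sum.
rewrite (_ : mx_sum _ _ k.+1 x = \1_D x + mxact T (mx_sum T (\1_D) k) x) //.
have TTB : k%:R * mxact T (\1_B) x - k%:R ^+ 2 * e <=
    mxact T (mx_sum T (\1_D) k) x.
  have := @mxact_affine_le T (mx_sum T (\1_D) k) (fun y => k%:R * \1_B y)
    1 (k%:R ^+ 2 * e) x TT_T.
  rewrite (_ : mxact T (fun y => k%:R * \1_B y) x = k%:R * mxact T (\1_B) x).
    by rewrite mul1r lerBlDl; apply=> y; rewrite mul1r -lerBlDl.
  by rewrite /mxact mulr_sumr; apply: eq_bigr => y _; rewrite mulrCA.
apply: le_trans (lerD (lexx _) TTB); rewrite mulrSr.
have k_ge0 : 0 <= k%:R :> R by [].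
have ke_ge0 : 0 <= k%:R * e by rewrite mulr_ge0.
have [Bx|NBx] := pselect (B x).
  have := ler_wpM2l k_ge0 (TB x Bx).
  rewrite [\1_B x]indicE [\1_D x]indicE !mem_set /= ?mulr1n; [nra|exact: BD|by []].
have TB_ge0 : 0 <= mxact T (\1_B) x.
  by apply: sumr_ge0 => y _; rewrite mulr_ge0 //; have [[]] := TT_T x.
have kTB_ge0 := mulr_ge0 k_ge0 TB_ge0.
have D_ge0 : 0 <= \1_D x :> R by rewrite indicE.
rewrite [\1_B x]indicE memNset // mulr0 sub0r; nra.
Qed.

(* If [B] can be left with arbitrarily small probability per step, a single
   transition matrix keeps the chain in [B] for [k] steps with probability close
   to one, although the set of matrices need not be closed. *)
Lemma not_weakly_ergodic (S B : set X) x z :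
  stable S -> S z -> B x -> B `<=` ~` S ->
  (forall y, B y -> 1 <= U (\1_B) y) -> ~ weakly_ergodic (models_ri Tx).
Proof.
move=> Sst Sz Bx BS UB /(_ (\1_(~` S)))[l lP].
have low k : 1 / 2 <= upper_av (models_ri Tx) k.+1 (\1_(~` S)) x.
  (* With this tolerance the quadratic loss is half of [k.+1]. *)
  have e_gt0 : 0 < (2 * k.+1%:R)^-1 :> R by rewrite invr_gt0 mulr_gt0.
  have [T [TT_T TU]] := upper_adherent (\1_B) e_gt0.
  apply: le_trans (upper_av_ri_ge (\1_(~` S)) k x TT_T).
  rewrite [leRHS]mulrC ler_pdivlMr //.
  apply: le_trans (@mx_sum_indic_ge T _ B _ k.+1 x TT_T (ltW e_gt0) BS _).
    rewrite indicE mem_set // mulr1.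
    rewrite (_ : _ ^+ 2 * _ = k.+1%:R / 2); first by lra.
    by field; rewrite nat1r pnatr_eq0.
  by move=> y By; apply: ltW; apply: le_lt_trans (TU y); rewrite lerD2r UB.
have high k : upper_av (models_ri Tx) k.+1 (\1_(~` S)) z <= 0.
  apply: le_trans (upper_av_ri_le_ei _ _ _) _.
  apply: le_trans (upper_av_ei_le _ _ _) _.
  by rewrite mulr_ge0_le0 ?invr_ge0 ?stable_upper_sum_le0.
have e8 : 0 < 1 / 8 :> R by lra.
have /cvgrPdist_le/(_ _ e8)[N _ NP] := lP x.
have /cvgrPdist_le/(_ _ e8)[M _ MP] := lP z.
have := NP (maxn N M).+1; have := MP (maxn N M).+1.
rewrite /= !leqW ?leq_maxl ?leq_maxr // => /(_ isT) + /(_ isT).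
by have := low (maxn N M); have := high (maxn N M); rewrite !ler_norml; lra.
Qed.

Lemma reach_stable x : stable [set y | reach U x y].
Proof. by move=> y z /= xy yz; exact: connect_trans yz. Qed.

Lemma stable_upper_indic_ge1 (S : set X) x :
  stable S -> S x -> 1 <= U (\1_S) x.
Proof.
move=> Sst Sx; have [T TT_T] := transition_matrices_neq0.
apply: le_trans (mxact_le_upper (\1_S) x TT_T).
have [[_ T_sum] _] := TT_T x.
have T1 : mxact T (fun=> 1) x = 1.
  by rewrite -[RHS]T_sum; apply: eq_bigr => y _; rewrite mulr1.
rewrite -[leLHS]T1 -[leRHS]add0r -[mxact T (\1_S) x]mul1r.
apply: stable_mxact_le Sst TT_T Sx _ => y Sy.
by rewrite add0r mul1r indicE mem_set.
Qed.

Lemma weakly_ergodic_TCA (x1 : X) : weakly_ergodic (models_ri Tx) -> TCA U.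
Proof.
move=> erg.
(* Whatever [z] reaches must reach back, as it would otherwise have fewer reachable states; so [C]
   is the candidate top class. *)
case: (@arg_minP _ nat _ x1 predT (fun x => #|reach U x|)) => // z _ zmin.
pose C := [set y | reach U z y].
have Cst : stable C := @reach_stable z.
have Cz : C z by exact: connect0.
have Creach y : C y -> reach U y z.
  move=> zy; apply/negPn/negP => Nyz.
  suff : (#|reach U y| < #|reach U z|)%N by rewrite ltnNge [(_ <= _)%N]zmin.
  apply: proper_card; apply/properP; split; last by exists z.
  by apply/fintype.subsetP => v; rewrite !unfold_in; exact: connect_trans.
(* Otherwise the set reachable from [x] is stable and misses [C]. *)
have allreach x : reach U x z.
  apply/negPn/negP => Nxz.
  apply: (@not_weakly_ergodic C [set y | reach U x y] x z) erg => //=.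
  - exact: connect0.
  - move=> y /= xy Cy; move/negP: Nxz; apply.
    exact: connect_trans xy (Creach y Cy).
  - by move=> y; exact: stable_upper_indic_ge1 (@reach_stable x).
exists C; split.
  split.
    exists z; apply/seteqP; split=> [y Cy|y []//]; split=> //; exact: Creach.
  move=> _ [a ->]; exists a, z; split=> //=.
  by split; exact: connect0.
split; first by split; [exists z|move=> x y Cx NCy xy; apply: NCy; exact: Cst xy].
move=> x NCx; apply: contrapT => Nk.
pose u k := iter k U (\1_(~` C) : X -> R).
(* The states from which [C] can be avoided for any number of steps with upper probability 1; [x] is
   one if it violates absorption. *)
pose B := [set y | forall k, u k y = 1].
apply: (@not_weakly_ergodic C B x z) erg => //.
- move=> k; apply/eqP; rewrite eq_le upper_indic_le1 /=.
  case: k => [|k]; first by rewrite /u /= indicE mem_set.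
  by rewrite leNgt; apply/negP => uk; apply: Nk; exists k.+1.
- move=> y /(_ 0%N); rewrite /u /= => + Cy.
  rewrite indicE memNset => [/eqP|/(_ Cy)//].
  by rewrite eq_sym oner_eq0.
have [|y|K [_ KP]] := @finite_uniform _ nat X
    (fun y k => B y \/ u k y < 1) 0%N.
- move=> y k m km [|uk]; first by left.
  by right; apply: le_lt_trans uk; exact: stable_upper_indic_decr.
- have [|/existsNP[k /eqP uk]] := pselect (B y); first by exists 0%N; left.
  by exists k; right; rewrite lt_neqAle uk upper_indic_le1.
(* Off [B], [u K] is at most [g yM < 1], and on [B] at most 1. Applying [U] to this comparison at
   [y] in [B], where [u K.+1 y = 1], forces [U (\1_B) y >= 1]. *)
pose g y := if y \in B then 0 else u K y.
case: (@arg_maxP _ _ _ z predT g) => // yM _ yMP.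
have g_lt1 : g yM < 1.
  by rewrite /g; case: ifPn => // /negP NB; case: (KP yM) => // By; case: NB; rewrite inE.
move=> y By; have := By K.+1.
have g1_ge0 : 0 <= 1 - g yM by rewrite subr_ge0 ltW.
have := @upper_affine_le (\1_B) (u K) (1 - g yM) (g yM) y g1_ge0.
rewrite /u iterS -/(u K) => + Uu1; rewrite Uu1 => H.
suff : 1 - g yM <= (1 - g yM) * U (\1_B) y.
  by rewrite -[leLHS]mulr1 ler_pM2l // subr_gt0.
rewrite lerBlDl; apply: H => v; rewrite indicE.
have [vB|vB] := boolP (v \in B).
  by rewrite mulr1 addrC subrK upper_indic_le1.
rewrite mulr0 addr0; have /= := yMP v isT; apply: le_trans.
by rewrite /g (negPf vB).
Qed.

End UpperTransition.

Theorem theorem22 (R : realType) (X : finType) (Tx : X -> set (X -> R))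
    (X_gt0 : (0 < #|X|)%N)
    (Tx_neq0 : forall x, Tx x !=set0)
    (Tx_mass : forall x p, Tx x p -> mass_function p) :
  (weakly_ergodic (models_ri Tx) <-> TCA (upper_transition Tx)) /\
  (weakly_ergodic (models_ri Tx) ->
    forall f : X -> R, exists l : R,
      upper_av_limit (models_ri Tx) f l /\ upper_av_limit (models_ei Tx) f l).
Proof.
have [x0 _] : exists x : X, x \in X by apply/card_gt0P.
have tcaP : weakly_ergodic (models_ri Tx) -> TCA (upper_transition Tx).
  exact: weakly_ergodic_TCA.
split; last by move=> /tcaP tca f; exact: TCA_limits.
split=> // tca f.
by have [l [lri _]] := TCA_limits Tx_neq0 Tx_mass x0 f tca; exists l.
Qed.
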